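(* Let $U=\mathbb{C}[[t]][t^{-1}]$ (formal Laurent series $a(t)$ in $t$), regarded as a differential commutative associative algebra with unit $1$ and derivation $\partial = d/dt$, and hence as a commutative vertex algebra with vacuum $1$, translation operator $\partial$, and $$Y(a(t),z)\,b(t)=(e^{z\partial}a(t))\,b(t)=i_{|z|<|t|}\,a(t+z)\,b(t),\qquad a(t),b(t)\in U,$$ where $i_{|z|<|t|}$ means expanding $a(t+z)$ in positive powers of $z/t$. Let $N=\mathbb{C}[\partial]\,n$ be a free $\mathbb{C}[\partial]$-module of rank $1$. Then there exists a unique vertex algebra structure on the $\mathbb{C}[\partial]$-module $V=U\oplus N$ (with translation operator $T=\partial$) such that $$Y(a(t),z)\,b(t)=i_{|z|<|t|}\,a(t+z)\,b(t),\qquad Y(n,z)\,n=0,\qquad Y(a(t),z)\,n=a(z)\,n$$ for all $a(t),b(t)\in U$. Moreover, the central series of the underlying Lie conformal algebra $V^{\mathrm{lie}}$ of $V$ (with $\lambda$-bracket $[a_\lambda b]=\sum_{n\ge 0}\frac{\lambda^n}{n!}a_{(n)}b$) stabilizes to $N$.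
   Context: Work over $\mathbb{C}$. A vertex algebra is a vector space with vacuum vector, infinitesimal translation operator $T$ and state-field correspondence $Y(a,z)=\sum_n a_{(n)}z^{-n-1}$ satisfying vacuum, translation invariance and locality axioms. The central series of a Lie conformal algebra $L$ is $L^{[0]}=L$, $L^{[k+1]}=[L,L^{[k]}]$, where $[A,B]$ is the $\mathbb{C}[\partial]$-submodule generated by all $a_{(j)}b$, $a\in A$, $b\in B$, $j\ge 0$; for finite (finitely generated over $\mathbb{C}[\partial]$) Lie conformal algebras it stabilizes to an ideal $L^{[\infty]}$. *)

(* Defs.v *)
From HB Require Import structures.
From Stdlib Require Import ProofIrrelevance FunctionalExtensionality ClassicalEpsilon.
From mathcomp Require Import all_boot all_order all_algebra.
From mathcomp Require Import complex.
From mathcomp Require Import boolp reals Rstruct.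
From mathcomp Require Import zify.

Set Implicit Arguments.
Unset Strict Implicit.
Unset Printing Implicit Defensive.

Import Order.TTheory GRing.Theory Num.Theory.
Local Open Scope ring_scope.

Definition C : fieldType := (Rdefinitions.R)[i].

(* Y n a b  stands for the n-th product  a_(n) b, i.e.                       *)
(*   Y(a,z) b = \sum_{n in Z} a_(n) b z^{-n-1}.                              *)
Definition vertex_algebra (K : fieldType) (V : lmodType K) (vac : V)
    (T : V -> V) (Y : int -> V -> V -> V) : Prop :=
      (forall (c : K) (u v : V), T (c *: u + v) = c *: T u + T v) /\
  [/\
      ((forall n (c : K) (u v w : V), Y n (c *: u + v) w = c *: Y n u w + Y n v w) /\
       (forall n (c : K) (u v w : V), Y n w (c *: u + v) = c *: Y n w u + Y n w v)),
      (forall a b : V, exists M : int, forall n : int, M <= n -> Y n a b = 0),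
      (* vacuum axioms: Y(vac,z) = Id, Y(a,z)vac = a + z V[[z]], T vac = 0 *)
      [/\ (forall (n : int) (a : V), Y n vac a = if n == -1 then a else 0),
          (forall a : V, Y (-1) a vac = a),
          (forall (n : nat) (a : V), Y n%:Z a vac = 0) &
          T vac = 0],
      (* translation invariance: [T, Y(a,z)] = d/dz Y(a,z) *)
      (forall (n : int) (a b : V), T (Y n a b) - Y n a (T b) = - (n%:~R : K) *: Y (n - 1) a b) &
      (* locality: (z-w)^N [Y(a,z), Y(b,w)] = 0 for some N, written on modes *)
      (forall a b : V, exists N : nat, forall (m n : int) (c : V),
         \sum_(j < N.+1) ((-1) ^+ j * 'C(N, j)%:R : K) *:
            (Y (m + N%:Z - j%:Z) a (Y (n + j%:Z) b c)
             - Y (n + j%:Z) b (Y (m + N%:Z - j%:Z) a c)) = 0)].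

Definition Tsubmodule (K : fieldType) (V : lmodType K) (T : V -> V) (S : V -> Prop) : Prop :=
  [/\ S 0, (forall u v, S u -> S v -> S (u + v)), (forall (c : K) u, S u -> S (c *: u))
    & (forall u, S u -> S (T u))].

Definition Tspan (K : fieldType) (V : lmodType K) (T : V -> V) (A : V -> Prop) : V -> Prop :=
  fun v => forall S, Tsubmodule T S -> (forall a, A a -> S a) -> S v.

(* Central series of the Lie conformal algebra V^lie (the lambda-bracket's   *)
(* coefficients are the products a_(j) b, j >= 0):                           *)
(*   L^[0] = V,  L^[k+1] = C[T]-span of { a_(j) b | a in V, b in L^[k], j>=0 } *)
Fixpoint central_series (K : fieldType) (V : lmodType K) (T : V -> V)
    (Y : int -> V -> V -> V) (k : nat) : V -> Prop :=
  match k with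
  | 0 => fun _ => True
  | k'.+1 => Tspan T (fun v => exists (a b : V) (j : nat),
                          central_series T Y k' b /\ v = Y j%:Z a b)
  end.

Record laurent := Laurent {
  lcoef : int -> C ;
  lcoef_lb : exists m : int, forall k : int, k < m -> lcoef k = 0 }.

Lemma laurent_ext (a b : laurent) : lcoef a =1 lcoef b -> a = b.
Proof.
case: a b => fa pa [fb pb] /= H.
have E : fa = fb by apply: functional_extensionality.
subst fb; congr Laurent; exact: proof_irrelevance.
Qed.

HB.instance Definition _ := gen_eqMixin laurent.
HB.instance Definition _ := gen_choiceMixin laurent.

Definition lzero : laurent.
Proof. by exists (fun _ => 0); exists 0. Defined.

Definition ladd (a b : laurent) : laurent.
Proof.
exists (fun k => lcoef a k + lcoef b k).
case: (lcoef_lb a) => ma Ha; case: (lcoef_lb b) => mb Hb.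
exists (Num.min ma mb) => k Hk.
rewrite Ha ?Hb ?addr0 //.
  by apply: (lt_le_trans Hk); rewrite ge_min lexx orbT.
by apply: (lt_le_trans Hk); rewrite ge_min lexx.
Defined.

Definition lopp (a : laurent) : laurent.
Proof.
exists (fun k => - lcoef a k).
case: (lcoef_lb a) => ma Ha; exists ma => k Hk; by rewrite Ha ?oppr0.
Defined.

Definition lscale (c : C) (a : laurent) : laurent.
Proof.
exists (fun k => c * lcoef a k).
case: (lcoef_lb a) => ma Ha; exists ma => k Hk; by rewrite Ha ?mulr0.
Defined.

Lemma laddA : associative ladd.
Proof. by move=> a b c; apply: laurent_ext => k /=; rewrite addrA. Qed.
Lemma laddC : commutative ladd.
Proof. by move=> a b; apply: laurent_ext => k /=; rewrite addrC. Qed.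
Lemma ladd0 : left_id lzero ladd.
Proof. by move=> a; apply: laurent_ext => k /=; rewrite add0r. Qed.
Lemma laddN : left_inverse lzero lopp ladd.
Proof. by move=> a; apply: laurent_ext => k /=; rewrite addNr. Qed.

HB.instance Definition _ := GRing.isZmodule.Build laurent laddA laddC ladd0 laddN.

Lemma lscaleA a b v : lscale a (lscale b v) = lscale (a * b) v.
Proof. by apply: laurent_ext => k /=; rewrite mulrA. Qed.
Lemma lscale1 : left_id 1 lscale.
Proof. by move=> a; apply: laurent_ext => k /=; rewrite mul1r. Qed.
Lemma lscaleDr : right_distributive lscale +%R.
Proof. by move=> c a b; apply: laurent_ext => k /=; rewrite mulrDr. Qed.
Lemma lscaleDl v : {morph lscale^~ v : a b / a + b}.
Proof. by move=> a b; apply: laurent_ext => k /=; rewrite mulrDl. Qed.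

HB.instance Definition _ :=
  GRing.Zmodule_isLmodule.Build C laurent lscaleA lscale1 lscaleDr lscaleDl.

Definition lone : laurent.
Proof.
exists (fun k => if k == 0 then 1 else 0).
exists 0 => k Hk; by rewrite (lt_eqF Hk).
Defined.

Definition lbound (a : laurent) : int :=
  proj1_sig (cid (lcoef_lb a)).

Lemma lboundP (a : laurent) k : k < lbound a -> lcoef a k = 0.
Proof. rewrite /lbound; case: cid => m Hm /=; exact: Hm. Qed.

(* Cauchy product:  (ab)_k = \sum_{i+j=k} a_i b_j  (a finite sum)          *)
Definition lmul_coef (a b : laurent) (k : int) : C :=
  \sum_(i < (absz (k - lbound a - lbound b)%R).+1)
     lcoef a (lbound a + i%:Z) * lcoef b (k - lbound a - i%:Z).

Lemma lmul_lb (a b : laurent) :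
  exists m : int, forall k : int, k < m -> lmul_coef a b k = 0.
Proof.
exists (lbound a + lbound b) => k Hk.
rewrite /lmul_coef big1 // => i _.
rewrite [lcoef b _]lboundP ?mulr0 //.
move: (nat_of_ord i) => j; move: (lbound a) (lbound b) Hk => la lb Hk.
lia.
Qed.

Definition lmul (a b : laurent) : laurent := Laurent (lmul_lb a b).

Definition lderiv (a : laurent) : laurent.
Proof.
exists (fun k => (k + 1)%:~R * lcoef a (k + 1)).
case: (lcoef_lb a) => ma Ha; exists (ma - 1) => k Hk.
by rewrite Ha ?mulr0 // -ltrBrDr.
Defined.

(* V = U (+) N with N = C[d] n free of rank one; an element p(d) n of N is  *)
(* represented by the polynomial p.  The translation operator T = d acts by *)
(* d/dt on U and by multiplication by the variable on N.                    *)
Definition V : lmodType C := (laurent * {poly C})%type.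

Definition inU (a : laurent) : V := (a, 0).
Definition ngen : V := (0, 1).
Definition vac : V := inU lone.
Definition Tv (v : V) : V := (lderiv v.1, 'X * v.2).

(* The three prescribed formulas of the theorem:
   Y(a(t),z) b(t) = i_{|z|<|t|} a(t+z) b(t) = \sum_{k>=0} z^k/k! (d^k a) b,
   Y(n,z) n = 0,   Y(a(t),z) n = a(z) n = \sum_k a_k z^k n. *)
Definition prescribed (Y : int -> V -> V -> V) : Prop :=
  [/\ (forall (a b : laurent) (k : nat),
         Y (- k%:Z - 1) (inU a) (inU b) = inU ((k`!%:R : C)^-1 *: lmul (iter k lderiv a) b)),
      (forall (a b : laurent) (k : nat), Y k%:Z (inU a) (inU b) = 0),
      (forall n : int, Y n ngen ngen = 0) &
      (forall (a : laurent) (n : int), Y n (inU a) ngen = lcoef a (- n - 1) *: ngen)].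

(* Main.v *)
Require Import Defs.
From mathcomp Require Import all_boot all_order all_algebra.
From mathcomp Require Import complex boolp Rstruct zify ring.

Set Implicit Arguments.
Unset Strict Implicit.
Unset Printing Implicit Defensive.

Import GRing.Theory.
Local Open Scope ring_scope.

(** On N = C[X] the prescription Y(a,z) n = a(z) n and translation covariance force
    Y(a,z) p(X) = p(X - d/dz) a(z), and skew-symmetry forces Y(n,z) a = e^(zX) a(-z) and
    Y(p(X) n, z) a = p(d/dz) e^(zX) a(-z). All these are determined by their values on
    n through the recursions given by X = T, so identities are proved by induction on
    the degree of p. The only nontrivial locality is that of Y(a,z) and Y(n,w): their
    commutator comes from the two expansions of a(z-w), so multiplying it by z-w
    replaces a by t a, and it vanishes when a is in C[[t]]. Conversely Y(a,z) is forced
    for a in U, and a field local with these and killing the vacuum is zero. *)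

Lemma natC_neq0 (n : nat) : (n.+1%:R : C) != 0.
Proof. exact: negbT (@Num.Theory.pnatr_eq0 (Rdefinitions.R)[i] n.+1). Qed.

Lemma factC_neq0 (n : nat) : (n`!%:R : C) != 0.
Proof. by rewrite -(prednK (fact_gt0 n)) natC_neq0. Qed.

(** * Linear maps out of K[X] prescribed on the powers of X *)

Section LinearExtension.
Context {K : comNzRingType} {W : lmodType K}.
Implicit Types (f g : nat -> W) (p q : {poly K}).

Definition linext f p : W := \sum_(k < size p) p`_k *: f k.

Lemma linextE n f p : (size p <= n)%N -> linext f p = \sum_(k < n) p`_k *: f k.
Proof.
move=> hn; rewrite /linext (big_ord_widen n (fun k => p`_k *: f k)) //.
rewrite [RHS](bigID (fun k : 'I_n => (k < size p)%N)) /=.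
rewrite [X in _ + X]big1 ?addr0 // => i; rewrite -leqNgt => hi.
by rewrite nth_default ?scale0r.
Qed.

Lemma linextP f c p q : linext f (c *: p + q) = c *: linext f p + linext f q.
Proof.
set n := maxn (size (c *: p + q)) (maxn (size p) (size q)).
rewrite !(@linextE n) ?leq_max ?leqnn ?orbT // scaler_sumr -big_split /=.
by apply: eq_bigr => i _; rewrite coefD coefZ scalerDl scalerA.
Qed.

Lemma linextC f c : linext f c%:P = c *: f 0%N.
Proof. by rewrite (@linextE 1) ?size_polyC_leq1 // big_ord1 coefC. Qed.

Lemma linextX f p : linext f ('X * p) = linext (fun k => f k.+1) p.
Proof.
rewrite (@linextE (size p).+1) ?size_mulXn //; last first.
  by rewrite mulrC; apply: leq_trans (size_polyMleq _ _) _; rewrite size_polyX addn2.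
rewrite big_ord_recl coefXM scale0r add0r; apply: eq_bigr => i _.
by rewrite coefXM.
Qed.

End LinearExtension.

Lemma poly_indX (K : comNzRingType) (P : {poly K} -> Prop) :
    (forall c, P c%:P) -> (forall p q, P p -> P q -> P (p + q)) ->
    (forall p, P p -> P ('X * p)) -> forall p, P p.
Proof.
move=> PC PD PX; elim/poly_ind => [|p c IH]; first by rewrite -polyC0.
by apply: PD; rewrite // mulrC; apply: PX.
Qed.

(** * Orders of Laurent series and multiplication by t *)

Definition vge (L : int) (a : laurent) : Prop := forall k : int, k < L -> lcoef a k = 0.

Lemma vgeW L L' a : vge L' a -> L <= L' -> vge L a.
Proof. by move=> ha h k hk; apply: ha; lia. Qed.

Lemma vge_exists a : exists L, vge L a.
Proof. exact: lcoef_lb. Qed.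

Lemma vgeD L a b : vge L a -> vge L b -> vge L (a + b).
Proof. by move=> ha hb k hk /=; rewrite ha ?hb ?addr0. Qed.

Lemma vgeZ L c a : vge L a -> vge L (c *: a).
Proof. by move=> ha k hk /=; rewrite ha ?mulr0. Qed.

Lemma vgeN L a : vge L a -> vge L (- a).
Proof. by move=> ha k hk /=; rewrite ha ?oppr0. Qed.

Lemma vge_deriv L a : vge L a -> vge (L - 1) (lderiv a).
Proof. by move=> ha k hk /=; rewrite ha ?mulr0 //; lia. Qed.

(** A shift of coefficients instead of a Cauchy product, so that injectivity and the effect on
    orders are immediate. *)
Definition tmul (a : laurent) : laurent.
Proof.
exists (fun k => lcoef a (k - 1)).
by have [m hm] := vge_exists a; exists m => k hk; apply: hm; lia.
Defined.

Lemma tmul0 : tmul 0 = 0.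
Proof. exact: laurent_ext. Qed.

Lemma tmul_inj : injective tmul.
Proof.
move=> a b h; apply: laurent_ext => k.
by have := congr1 (fun x => lcoef x (k + 1)) h; rewrite /= addrK.
Qed.

Lemma vge_iter_tmul L N a : vge L a -> vge (L + N%:Z) (iter N tmul a).
Proof.
elim: N L => [|N IH] L ha; first by rewrite addr0.
by move=> k hk /=; apply: (IH L ha); lia.
Qed.

Lemma vge_regular a : exists N, vge 0 (iter N tmul a).
Proof.
have [L hL] := vge_exists a; exists `|L|%N.
apply: (vgeW (vge_iter_tmul (N := `|L|%N) hL)); lia.
Qed.

Lemma laurent_split a : vge 0 a ->
  exists2 a', vge 0 a' & a = lcoef a 0 *: lone + tmul a'.
Proof.
move=> ha; have hP : exists m : int, forall k, k < m -> (if k < 0 then 0 else lcoef a (k + 1)) = 0.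
  by exists 0 => k ->.
exists (Laurent hP); first by move=> k hk /=; rewrite hk.
apply: laurent_ext => k /=; case: eqP => [->|hk]; first by rewrite mulr1 addr0.
rewrite mulr0 add0r; case: ifP => hk1; first by rewrite ha //; lia.
by rewrite subrK.
Qed.

(* A t-linear bounded map that vanishes at 1 is t-adically arbitrarily small on
   C[[t]], hence zero. *)
Lemma tlinear_eq0 (f : laurent -> laurent) :
    (forall c a, f (c *: lone + tmul a) = tmul (f a)) ->
    (exists L, forall a, vge 0 a -> vge L (f a)) -> forall a, f a = 0.
Proof.
move=> ft [L fL].
have freg a : vge 0 a -> f a = 0.
  move=> ha; apply: laurent_ext => k.
  have : k < L + (`|k - L|.+1)%:Z by lia.
  move: (`|k - L|.+1)%N => N; elim: N k a ha => [|N IH] k a ha hk.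
    by apply: (fL a ha); lia.
  by have [a' ha' ->] := laurent_split ha; rewrite ft /= IH //; lia.
(* A power of t brings any series into C[[t]]. Taking c = 0 in the hypothesis, f commutes with t,
   and t is cancelled by injectivity. *)
move=> a; have [N] := vge_regular a; elim: N a => [|N IH] a; first exact: freg.
rewrite iterSr => /IH h; apply: tmul_inj.
by rewrite tmul0 -(ft 0) scale0r add0r.
Qed.

(** * The Cauchy product of Laurent series *)

Definition lmul_sum a b (k lo : int) (n : nat) : C :=
  \sum_(0 <= i < n) lcoef a (lo + i%:Z) * lcoef b (k - lo - i%:Z).

(** The d terms added on the left vanish by the bound on a, the e terms added on the right by the
    bound on b. *)
Lemma lmul_sum_widen a b k lo n d e :
    vge lo a -> vge (k - lo - n%:Z + 1) b ->
  lmul_sum a b k (lo - d%:Z) (d + n + e) = lmul_sum a b k lo n.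
Proof.
move=> ha hb; rewrite /lmul_sum (@big_cat_nat _ _ _ d) //=; last by lia.
rewrite big1_seq ?add0r => [|i]; last first.
  by rewrite mem_index_iota => hi; rewrite ha ?mul0r //; lia.
rewrite (@big_cat_nat _ _ _ (d + n)) //=; try lia.
rewrite [X in _ + X]big1_seq ?addr0 => [|i]; last first.
  by rewrite mem_index_iota => hi; rewrite hb ?mulr0 //; lia.
rewrite -{1}(add0n d) big_addn addnC addnK; apply: eq_bigr => i _.
by congr (lcoef a _ * lcoef b _); lia.
Qed.

(** The window of summation in [lmul_coef] comes from the arbitrarily chosen bounds [lbound].
    Independence of the window lets later proofs choose a convenient one, common to all products
    involved. *)
Lemma lmul_coef_sum a b k lo n :
    vge lo a -> vge (k - lo - n%:Z + 1) b ->
  lmul_coef a b k = lmul_sum a b k lo n.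
Proof.
move=> ha hb; have -> : lmul_coef a b k =
    lmul_sum a b k (lbound a) (`|(k - lbound a - lbound b)%R|).+1.
  by rewrite /lmul_sum big_mkord.
have ha1 : vge (lbound a) a by exact: lboundP.
have hb1 : vge (k - lbound a - (`|(k - lbound a - lbound b)%R|.+1)%:Z + 1) b.
  by apply: (@vgeW _ (lbound b)); [exact: lboundP | lia].
move: (lbound a) (_.+1) ha1 hb1 => l1 n1 ha1 hb1.
(* Both windows are widened to start at the smaller of the two lower ends, and the extra right-hand
   terms make the total lengths equal. *)
rewrite -(lmul_sum_widen (`|l1 - Num.min l1 lo|) (`|lo - Num.min l1 lo| + n) ha1 hb1).
rewrite -(lmul_sum_widen (`|lo - Num.min l1 lo|) (`|l1 - Num.min l1 lo| + n1) ha hb).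
by congr lmul_sum; lia.
Qed.

Lemma vge_exists2 a b : exists L, vge L a /\ vge L b.
Proof.
have [L hL] := vge_exists a; have [M hM] := vge_exists b.
exists (Num.min L M); split.
  by apply: (vgeW hL); lia.
by apply: (vgeW hM); lia.
Qed.

Lemma lmulPl b c a a' : lmul (c *: a + a') b = c *: lmul a b + lmul a' b.
Proof.
apply: laurent_ext => k /=; have [L [ha ha']] := vge_exists2 a a'.
have [M hb] := vge_exists b; have hb' : vge (k - L - (absz (k - L - M + 1))%:Z + 1) b.
  by apply: (vgeW hb); lia.
rewrite !(lmul_coef_sum _ hb') //; last by apply: vgeD => //; apply: vgeZ.
rewrite /lmul_sum mulr_sumr -big_split /=; apply: eq_bigr => i _.
by rewrite mulrDl mulrA.
Qed.

Lemma lmulPr b c a a' : lmul b (c *: a + a') = c *: lmul b a + lmul b a'.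
Proof.
apply: laurent_ext => k /=; have [L [ha ha']] := vge_exists2 a a'.
have [M hb] := vge_exists b; set n := absz (k - M - L + 1).
have hW x : vge L x -> vge (k - M - n%:Z + 1) x by move=> hx; apply: (vgeW hx); lia.
rewrite !(lmul_coef_sum hb (hW _ _)) //; last by apply: vgeD => //; apply: vgeZ.
rewrite /lmul_sum mulr_sumr -big_split /=; apply: eq_bigr => i _.
by rewrite mulrDr mulrCA.
Qed.

Lemma lmul0l b : lmul 0 b = 0.
Proof. by have := lmulPl b (-1) 0 0; rewrite scaleN1r oppr0 addr0 scaleN1r addNr. Qed.

Lemma lmul0r b : lmul b 0 = 0.
Proof. by have := lmulPr b (-1) 0 0; rewrite scaleN1r oppr0 addr0 scaleN1r addNr. Qed.

Lemma lmulZl b c a : lmul (c *: a) b = c *: lmul a b.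
Proof. by rewrite -[c *: a]addr0 lmulPl lmul0l addr0. Qed.

Lemma lmulDl b a a' : lmul (a + a') b = lmul a b + lmul a' b.
Proof. by rewrite -[a]scale1r lmulPl !scale1r. Qed.

Lemma lmul_tl a b : lmul (tmul a) b = tmul (lmul a b).
Proof.
apply: laurent_ext => k /=.
have [L ha] := vge_exists a; have [M hb] := vge_exists b.
set n := absz (k - M - L + 1).
rewrite (@lmul_coef_sum _ _ _ (L + 1) n); last by apply: (vgeW hb); lia.
  rewrite (@lmul_coef_sum _ _ _ L n) //; last by apply: (vgeW hb); lia.
  by apply: eq_bigr => i _ /=; congr (lcoef a _ * lcoef b _); lia.
by move=> i hi; apply: ha; lia.
Qed.

Lemma lmul_tr a b : lmul a (tmul b) = tmul (lmul a b).
Proof.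
apply: laurent_ext => k /=.
have [L ha] := vge_exists a; have [M hb] := vge_exists b.
set n := absz (k - M - L + 1).
rewrite (@lmul_coef_sum _ _ _ L n) //; last by move=> i hi; apply: hb; lia.
rewrite (@lmul_coef_sum _ _ _ L n) //; last by apply: (vgeW hb); lia.
by apply: eq_bigr => i _ /=; congr (lcoef a _ * lcoef b _); lia.
Qed.

Lemma lmul1l b : lmul lone b = b.
Proof.
apply: laurent_ext => k /=; have [M hb] := vge_exists b.
rewrite (@lmul_coef_sum _ _ _ 0 (absz (k - M + 1)).+1); last by apply: (vgeW hb); lia.
  rewrite /lmul_sum big_mkord big_ord_recl /= mul1r big1 => [|i _].
    by rewrite addr0 !subr0.
  by rewrite mul0r.
by move=> i hi /=; rewrite ifF //; lia.
Qed.

Lemma lmul1r b : lmul b lone = b.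
Proof.
apply: laurent_ext => k /=; have [M hb] := vge_exists b.
(* The minimum makes the window start no later than k and, with the length below, end exactly at k,
   so only its last term survives. *)
have hm : vge (Num.min M k) b by apply: (vgeW hb); lia.
rewrite (@lmul_coef_sum _ _ _ _ (absz (k - Num.min M k)).+1 hm).
  rewrite /lmul_sum big_mkord big_ord_recr /= big1 => [|i _].
    rewrite add0r ifT ?mulr1; last by lia.
    by congr lcoef; lia.
  by rewrite ifF ?mulr0 //; have := ltn_ord i; lia.
by move=> i hi /=; rewrite ifF //; lia.
Qed.

Lemma vge_lmul L M a b : vge L a -> vge M b -> vge (L + M) (lmul a b).
Proof.
move=> ha hb k hk /=; rewrite (@lmul_coef_sum _ _ _ L 0) //.
  by rewrite /lmul_sum big_nil.
by apply: (vgeW hb); lia.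
Qed.

(** The difference of the two sides is t-linear in a, vanishes at a = 1 and is bounded on C[[t]], so
    no double sum has to be reindexed. *)
Lemma lmul_leftC a b c : lmul a (lmul b c) = lmul b (lmul a c).
Proof.
apply: subr0_eq; move: a; apply: tlinear_eq0 => [k a|].
  rewrite !lmulPl !lmulPr !lmul1l !lmul_tl lmul_tr.
  by apply: laurent_ext => i /=; ring.
have [M [hb hc]] := vge_exists2 b c; exists (0 + (M + M)) => a ha.
apply: vgeD; first by apply: vge_lmul => //; apply: vge_lmul.
by apply/vgeN; apply: (vgeW (vge_lmul hb (vge_lmul ha hc))); lia.
Qed.

(** * The derivation d/dt and the Taylor expansion of a(t+z) *)

Lemma lderivP c a b : lderiv (c *: a + b) = c *: lderiv a + lderiv b.
Proof. by apply: laurent_ext => k /=; ring. Qed.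

Lemma lderivZ c a : lderiv (c *: a) = c *: lderiv a.
Proof. by apply: laurent_ext => k /=; ring. Qed.

Lemma lderiv1 : lderiv lone = 0.
Proof.
apply: laurent_ext => k /=; case: eqP => [->|_]; first by rewrite mul0r.
by rewrite mulr0.
Qed.

Lemma lderiv_t a : lderiv (tmul a) = a + tmul (lderiv a).
Proof.
apply: laurent_ext => k /=; rewrite addrK subrK intrD mulrDl mul1r.
by rewrite addrC.
Qed.

(** The individual terms are not t-linear in a, but the defect of the Leibniz rule is: the extra
    copies of a b produced by differentiating t cancel. *)
Lemma lderivM a b : lderiv (lmul a b) = lmul (lderiv a) b + lmul a (lderiv b).
Proof.
apply: subr0_eq; move: a; apply: tlinear_eq0 => [k a|].
  rewrite lmulPl lmul1l lmul_tl !lderivP !lderiv_t lderiv1 scaler0 add0r.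
  rewrite lmulPl lmul1l lmulDl !lmul_tl.
  by apply: laurent_ext => i /=; ring.
have [M hb] := vge_exists b; exists (M - 1) => a ha.
have hb' := vge_deriv hb; have ha' := vge_deriv ha.
apply: vgeD; first by apply: (vgeW (vge_deriv (vge_lmul ha hb))); lia.
apply: vgeN; apply: vgeD; first by apply: (vgeW (vge_lmul ha' hb)); lia.
by apply: (vgeW (vge_lmul ha hb')); lia.
Qed.

(* The coefficient of z^(-n-1) in a(t+z). *)
Definition hs (a : laurent) (n : int) : laurent :=
  if n is Negz q then (q`!%:R : C)^-1 *: iter q lderiv a else 0.

Lemma hs_ge0 a n : 0 <= n -> hs a n = 0.
Proof. by case: n. Qed.

Lemma hsN1 a : hs a (-1) = a.
Proof. by rewrite /= fact0 invr1 scale1r. Qed.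

Lemma hsP n c a b : hs (c *: a + b) n = c *: hs a n + hs b n.
Proof.
case: n => q /=; first by rewrite scaler0 addr0.
have -> : iter q lderiv (c *: a + b) = c *: iter q lderiv a + iter q lderiv b.
  by elim: q => //= q ->; rewrite lderivP.
by apply: laurent_ext => k /=; ring.
Qed.

Lemma hsS a q : hs a (Negz q.+1) = (q.+1%:R : C)^-1 *: lderiv (hs a (Negz q)).
Proof.
rewrite /= lderivZ scalerA; congr (_ *: _).
by rewrite factS natrM invfM.
Qed.

(** The derivatives of a(t+z) in t and in z coincide. *)
Lemma lderiv_hs a n : lderiv (hs a n) = (- n)%:~R *: hs a (n - 1).
Proof.
case: n => q.
  rewrite [hs a q]hs_ge0 //; case: q => [|q]; last rewrite [hs a _]hs_ge0; try lia.
    by apply: laurent_ext => k /=; ring.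
  by apply: laurent_ext => k /=; ring.
have -> : Negz q - 1 = Negz q.+1 by lia.
have -> : - Negz q = q.+1 by [].
by rewrite hsS scalerA divff ?scale1r // natC_neq0.
Qed.

(** Substituting t+z in t a gives (t+z) a(t+z), and the factor z raises the mode index by one. *)
Lemma hs_t a n : hs (tmul a) n = hs a (n + 1) + tmul (hs a n).
Proof.
case: n => q; first by rewrite !hs_ge0 ?tmul0 ?addr0 //; lia.
elim: q => [|q IH].
  by rewrite [hs a _]hs_ge0 // add0r; apply: laurent_ext.
rewrite hsS IH -[X in X + _]scale1r lderivP lderiv_t !lderiv_hs scale1r.
have -> : Negz q + 1 - 1 = Negz q by lia.
have -> : Negz q.+1 + 1 = Negz q by lia.
have -> : Negz q - 1 = Negz q.+1 by lia.
have -> : - Negz q = q.+1 by [].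
have -> : - (Negz q + 1) = q by lia.
have := natC_neq0 q; move: (hs a (Negz q)) (hs a (Negz q.+1)) => x y h.
apply: laurent_ext => k /=; move: (lcoef x k) (lcoef y _) => u v.
by rewrite -!pmulrn; move: h; rewrite -[q.+1]addn1 natrD => h; field.
Qed.

Lemma hs1 n : hs lone n = if n == -1 then lone else 0.
Proof.
case: n => [q|[|q]] //=; first by rewrite fact0 invr1 scale1r.
have -> : lderiv (iter q lderiv lone) = 0; last by rewrite scaler0.
elim: q => [|q /= ->]; first exact: lderiv1.
by apply: laurent_ext => k /=; rewrite mulr0.
Qed.

Lemma vge_hs a n : vge 0 a -> vge 0 (hs a n).
Proof.
move=> ha; case: n => q //=; apply: vgeZ; elim: q => //= q IH k hk /=.
case: (k =P -1) => [->|h]; first by rewrite mul0r.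
by rewrite IH ?mulr0 //; lia.
Qed.

(** * The field Y(n,z) on U *)

Lemma exprN1_S (k : int) : (-1 : C) ^ (k + 1) = - (-1) ^ k.
Proof. by rewrite expfzDr ?oppr_eq0 ?oner_eq0 // expr1z mulrN1. Qed.

(* The coefficient of z^(-n-1) in Y(n,z) c = e^(zX) c(-z). *)
Definition nbase (n : int) (c : laurent) : {poly C} :=
  \poly_(i < (absz (-1 - n - lbound c)%R).+1)
     ((-1) ^ (n + 1 + i%:Z) * lcoef c (-1 - n - i%:Z) / i`!%:R).

(** Truncation loses nothing: beyond it the index -1-n-i lies below [lbound c]. *)
Lemma coef_nbase n c i :
  (nbase n c)`_i = (-1) ^ (n + 1 + i%:Z) * lcoef c (-1 - n - i%:Z) / i`!%:R.
Proof.
rewrite coef_poly; case: ifP => // hi.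
by rewrite (@lboundP c) ?mulr0 ?mul0r //; lia.
Qed.

Lemma nbaseP n k c d : nbase n (k *: c + d) = k *: nbase n c + nbase n d.
Proof. by apply/polyP => i; rewrite coefD coefZ !coef_nbase /=; ring. Qed.

(** In c(-z), multiplication by t becomes multiplication by -z. *)
Lemma nbase_t n c : nbase n (tmul c) = - nbase (n + 1) c.
Proof.
apply/polyP => i; rewrite coefN !coef_nbase /=.
have -> : n + 1 + 1 + i%:Z = n + 1 + i%:Z + 1 by ring.
have -> : -1 - (n + 1) - i%:Z = -1 - n - i%:Z - 1 by ring.
by rewrite exprN1_S; ring.
Qed.

(** Differentiating e^(zX) in X multiplies it by z. *)
Lemma deriv_nbase n c : (nbase n c)^`() = nbase (n + 1) c.
Proof.
apply/polyP => i; rewrite coef_deriv !coef_nbase.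
have -> : n + 1 + i.+1%:Z = n + 1 + 1 + i%:Z by lia.
have -> : -1 - n - i.+1%:Z = -1 - (n + 1) - i%:Z by lia.
rewrite -[LHS]mulr_natr factS natrM; have := natC_neq0 i; have := factC_neq0 i.
move: (_ ^ _) (lcoef _ _) (i`!%:R : C) (i.+1%:R : C) => x y u v hu hv.
by field; rewrite hu hv.
Qed.

Lemma nbase_eq0 L n c : vge L c -> - L <= n -> nbase n c = 0.
Proof.
move=> hc hn; apply/polyP => i; rewrite coef_nbase coef0 hc ?mulr0 ?mul0r //.
by lia.
Qed.

Lemma nbaseN1_vac : nbase (-1) lone = 1.
Proof.
apply/polyP => i; rewrite coef_nbase coef1.
case: i => [|i] /=; first by rewrite fact0 divr1 mul1r.
by rewrite mulr0 mul0r.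
Qed.

(** This is the product rule d/dz (e^(zX) c(-z)) = X e^(zX) c(-z) - e^(zX) c'(-z), read on
    coefficients. *)
Lemma nbase_transl n c :
  'X * nbase n c - nbase n (lderiv c) = (- n)%:~R *: nbase (n - 1) c.
Proof.
apply/polyP => i; rewrite coefB coefXM coefZ !coef_nbase.
have -> : n - 1 + 1 + i%:Z = n + i%:Z by ring.
have -> : -1 - (n - 1) - i%:Z = - n - i%:Z by ring.
have -> : n + 1 + i%:Z = n + i%:Z + 1 by ring.
have hd : lcoef (lderiv c) (-1 - n - i%:Z) = (- n - i%:Z)%:~R * lcoef c (- n - i%:Z).
  by rewrite /=; congr (_%:~R * lcoef _ _); ring.
rewrite hd exprN1_S; case: i {hd} => [|i] /=.
  by rewrite subr0 fact0 !divr1; ring.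
have -> : -1 - n - i%:Z = - n - i.+1%:Z by lia.
have -> : n + 1 + i%:Z = n + i.+1%:Z by lia.
rewrite factS natrM; have := natC_neq0 i; have := factC_neq0 i.
have -> : (- n - i.+1%:Z)%:~R = (- n)%:~R - i.+1%:R :> C by rewrite intrD mulrNz.
move: (_ ^ _) (lcoef _ _) (i`!%:R : C) (i.+1%:R : C) => x y u v hu hv.
by field; rewrite hu hv.
Qed.

(** * The fields between U and N for arbitrary elements of N *)

Fixpoint nactX (c : laurent) (k : nat) (n : int) : {poly C} :=
  if k is k'.+1 then (- n)%:~R *: nactX c k' (n - 1) else nbase n c.

(** The coefficient of z^(-n-1) in p(d/dz) e^(zX) c(-z). *)
Definition nact (p : {poly C}) n c := linext (fun k => nactX c k n) p.

(** The coefficient of z^(-n-1) in (X - d/dz)^k a(z); on coefficients, -d/dz is the shift from n to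
    n-1 followed by the factor n. *)
Fixpoint uactX (a : laurent) (k : nat) (n : int) : {poly C} :=
  if k is k'.+1 then 'X * uactX a k' n + n%:~R *: uactX a k' (n - 1)
  else (lcoef a (- n - 1))%:P.

Definition uact a n (p : {poly C}) := linext (fun k => uactX a k n) p.

Lemma nactPl n d c p q : nact (c *: p + q) n d = c *: nact p n d + nact q n d.
Proof. exact: linextP. Qed.

Lemma nactDl n d p q : nact (p + q) n d = nact p n d + nact q n d.
Proof. by rewrite -[p]scale1r nactPl !scale1r. Qed.

Lemma nactC n d c : nact c%:P n d = c *: nbase n d.
Proof. exact: linextC. Qed.

Lemma nactX_E n d p : nact ('X * p) n d = (- n)%:~R *: nact p (n - 1) d.
Proof.
rewrite /nact linextX /= /linext scaler_sumr.
by apply: eq_bigr => i _; rewrite !scalerA mulrC.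
Qed.

Lemma uactPr a n c p q : uact a n (c *: p + q) = c *: uact a n p + uact a n q.
Proof. exact: linextP. Qed.

Lemma uactDr a n p q : uact a n (p + q) = uact a n p + uact a n q.
Proof. by rewrite -[p]scale1r uactPr !scale1r. Qed.

Lemma uact0r a n : uact a n 0 = 0.
Proof. by rewrite -polyC0 /uact linextC scale0r. Qed.

Lemma uactZr a n c p : uact a n (c *: p) = c *: uact a n p.
Proof. by rewrite -[c *: p]addr0 uactPr uact0r addr0. Qed.

Lemma uactC a n c : uact a n c%:P = (c * lcoef a (- n - 1))%:P.
Proof. by rewrite /uact linextC /= polyCM mul_polyC. Qed.

Lemma uactX_E a n p :
  uact a n ('X * p) = 'X * uact a n p + n%:~R *: uact a (n - 1) p.
Proof.
rewrite /uact linextX /= /linext mulr_sumr scaler_sumr -big_split /=.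
by apply: eq_bigr => i _; rewrite scalerDr !scalerA scalerAr [_ * n%:~R]mulrC.
Qed.

Lemma uactPl c a b n p : uact (c *: a + b) n p = c *: uact a n p + uact b n p.
Proof.
elim/poly_indX: p n => [k|p q IHp IHq|p IH] n.
- by rewrite !uactC /= -mul_polyC -polyCM -polyCD; congr (_%:P); ring.
- by rewrite !uactDr IHp IHq scalerDr; ring.
- by rewrite !uactX_E !IH -!mul_polyC; ring.
Qed.

Lemma uact0l n p : uact 0 n p = 0.
Proof.
by have := uactPl (-1) 0 0 n p; rewrite scaler0 addr0 scaleN1r addNr.
Qed.

Lemma uact_lbound a p : exists M : int, forall n, M <= n -> uact a n p = 0.
Proof.
elim/poly_indX: p => [k|p q [M hM] [L hL]|p [M hM]].
- have [L hL] := vge_exists a; exists (- L) => n hn.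
  by rewrite uactC hL ?mulr0 ?polyC0 //; lia.
- exists (Num.max M L) => n hn; rewrite uactDr hM ?hL ?addr0 //; lia.
- exists (M + 1) => n hn; rewrite uactX_E !hM; try lia.
  by rewrite mulr0 scaler0 addr0.
Qed.

Lemma uact_comm a b m n p : uact a m (uact b n p) = uact b n (uact a m p).
Proof.
elim/poly_indX: p m n => [k|p q IHp IHq|p IH] m n.
- by rewrite !uactC mulrAC.
- by rewrite !uactDr IHp IHq.
- rewrite !uactX_E !uactDr !uactZr !uactX_E !IH -!mul_polyC; ring.
Qed.

(** The X-derivative of p(X - d/dz) a(z) is p'(X - d/dz) a(z). *)
Lemma uact_deriv a n p : uact a n p^`() = (uact a n p)^`().
Proof.
elim/poly_indX: p n => [k|p q IHp IHq|p IH] n.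
- by rewrite uactC !derivC uact0r.
- by rewrite derivD !uactDr derivD IHp IHq.
- rewrite derivM derivX mul1r !uactX_E uactDr uactX_E derivD derivM derivX mul1r.
  by rewrite derivZ !IH addrA.
Qed.

(** The commutator of p(X - d/dz) with z is -p'(X - d/dz), so t acts as z - d/dX. *)
Lemma uact_t a n p : uact (tmul a) n p = uact a (n + 1) p - (uact a n p)^`().
Proof.
elim/poly_indX: p n => [k|p q IHp IHq|p IH] n.
- rewrite !uactC derivC subr0 /=; congr (_ * lcoef a _)%:P; ring.
- by rewrite !uactDr derivD IHp IHq; ring.
- rewrite !uactX_E !IH derivD derivM derivX derivZ.
  have -> : n - 1 + 1 = n by ring.
  have -> : n + 1 - 1 = n by ring.
  by rewrite -!mul_polyC intrD; ring.
Qed.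

Lemma uact1 n p : uact lone n p = if n == -1 then p else 0.
Proof.
elim/poly_indX: p n => [k|p q IHp IHq|p IH] n.
- rewrite uactC /=; have -> : (- n - 1 == 0) = (n == -1) by lia.
  by case: ifP; rewrite ?mulr1 ?mulr0.
- by rewrite uactDr IHp IHq; case: ifP; rewrite ?addr0.
- rewrite uactX_E !IH; have -> : (n - 1 == -1) = (n == 0) by lia.
  case: (n =P 0) => [->|_]; first by rewrite scale0r addr0 /= mulr0.
  by rewrite scaler0 addr0; case: (n == -1); rewrite ?mulr0.
Qed.

Lemma uact_regular a n p : vge 0 a -> 0 <= n -> uact a n p = 0.
Proof.
move=> ha; elim/poly_indX: p n => [k|p q IHp IHq|p IH] n hn.
- by rewrite uactC ha ?mulr0 //; lia.
- by rewrite uactDr IHp ?IHq ?addr0.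
- rewrite uactX_E IH // mulr0 add0r; case: (n =P 0) => [->|h]; first exact: scale0r.
  by rewrite IH ?scaler0 //; lia.
Qed.

Lemma nactPr n p c a b : nact p n (c *: a + b) = c *: nact p n a + nact p n b.
Proof.
elim/poly_indX: p n => [k|p q IHp IHq|p IH] n.
- by rewrite !nactC nbaseP -!mul_polyC; ring.
- by rewrite !nactDl IHp IHq scalerDr; ring.
- by rewrite !nactX_E IH -!mul_polyC; ring.
Qed.

Lemma nact0l n d : nact 0 n d = 0.
Proof. by rewrite -polyC0 nactC scale0r. Qed.

Lemma nact0r n p : nact p n 0 = 0.
Proof.
by have := nactPr n p (-1) 0 0; rewrite scaler0 addr0 scaleN1r addNr.
Qed.

Lemma nact_lbound p d : exists M : int, forall n, M <= n -> nact p n d = 0.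
Proof.
elim/poly_indX: p => [k|p q [M hM] [L hL]|p [M hM]].
- have [L hL] := vge_exists d; exists (- L) => n hn.
  by rewrite nactC (nbase_eq0 hL) // scaler0.
- exists (Num.max M L) => n hn; rewrite nactDl hM ?hL ?addr0 //; lia.
- by exists (M + 1) => n hn; rewrite nactX_E hM ?scaler0 //; lia.
Qed.

Lemma nact_transl n p d :
  'X * nact p n d - nact p n (lderiv d) = (- n)%:~R *: nact p (n - 1) d.
Proof.
elim/poly_indX: p n => [k|p q IHp IHq|p IH] n.
- by rewrite !nactC -scalerAr -scalerBr nbase_transl !scalerA mulrC.
- by rewrite !nactDl scalerDr -!IHp -!IHq; ring.
- by rewrite !nactX_E -scalerAr -scalerBr IH.
Qed.

Lemma nact_vac_ge0 p n : 0 <= n -> nact p n lone = 0.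
Proof.
have h1 : vge 0 lone by move=> k hk /=; rewrite ifF //; lia.
elim/poly_indX: p n => [k|p q IHp IHq|p IH] n hn.
- by rewrite nactC (nbase_eq0 h1) // scaler0.
- by rewrite nactDl IHp ?IHq ?addr0.
- rewrite nactX_E; case: (n =P 0) => [->|h]; first exact: scale0r.
  by rewrite IH ?scaler0 //; lia.
Qed.

Lemma nactN1_vac p : nact p (-1) lone = p.
Proof.
elim/poly_indX: p => [k|p q IHp IHq|p IH].
- by rewrite nactC nbaseN1_vac -mul_polyC mulr1.
- by rewrite nactDl IHp IHq.
- have := nact_transl (-1) p lone.
  by rewrite nactX_E lderiv1 nact0r subr0 IH => ->.
Qed.

(** * Locality as annihilation by a power of z - w *)

Section Locality.
Context {K : fieldType} {W : lmodType K}.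
Implicit Types (F G : int -> int -> W) (N : nat).

(* Multiplication by z - w, read on the coefficients F m n of z^(-m-1) w^(-n-1). *)
Definition dz F (m n : int) : W := F (m + 1) n - F m (n + 1).

Definition vanish N F := forall m n, iter N dz F m n = 0.

Lemma eq_iter_dz N F G : F =2 G -> iter N dz F =2 iter N dz G.
Proof. by move=> h; elim: N => //= N IH m n; rewrite /dz !IH. Qed.

Lemma iter_dzP N c F G m n :
  iter N dz (fun m n => c *: F m n + G m n) m n = c *: iter N dz F m n + iter N dz G m n.
Proof.
elim: N m n => //= N IH m n; rewrite /dz !IH scalerBr.
by rewrite opprD addrACA.
Qed.

Lemma iter_dz_swap N F m n :
  iter N dz (fun m n => F n m) m n = (-1) ^+ N *: iter N dz F n m.
Proof.
elim: N m n => [|N IH] m n /=; first by rewrite expr0 scale1r.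
by rewrite /dz !IH -scalerBr exprS mulN1r scaleNr -scalerN opprB.
Qed.

Lemma vanishW N M F : vanish N F -> (N <= M)%N -> vanish M F.
Proof.
move=> h /subnK <-; elim: (M - N)%N => // d IH m n.
by rewrite addSn /= /dz !IH subr0.
Qed.

Lemma vanishP N c F G :
  vanish N F -> vanish N G -> vanish N (fun m n => c *: F m n + G m n).
Proof. by move=> hF hG m n; rewrite iter_dzP hF hG scaler0 addr0. Qed.

Lemma vanish_swap N F : vanish N F -> vanish N (fun m n => F n m).
Proof. by move=> hF m n; rewrite iter_dz_swap hF scaler0. Qed.

Lemma vanish0 N : vanish N (fun _ _ => 0).
Proof. by elim: N => // N IH m n; rewrite /= /dz !IH subr0. Qed.

(* The differentiation in w commutes with multiplication by z - w up to the identity. *)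
Lemma iter_dz_dw N F m n :
  iter N.+1 dz (fun m n => (- n)%:~R *: F m (n - 1)) m n =
  (- n)%:~R *: iter N.+1 dz F m (n - 1) + N.+1%:R *: iter N dz F m n.
Proof.
elim: N m n => [|N IH] m n.
  rewrite /= /dz; have -> : n - 1 + 1 = n by ring.
  have -> : n + 1 - 1 = n by ring.
  by rewrite opprD intrD mulrN1z scale1r scalerBr scalerDl scaleN1r opprD opprK addrA.
rewrite iterS {1}/dz !IH; have -> : n + 1 - 1 = n by ring.
have -> : iter N.+2 dz F m (n - 1) =
    iter N.+1 dz F (m + 1) (n - 1) - iter N.+1 dz F m (n - 1 + 1) by [].
have -> : n - 1 + 1 = n by ring.
have hB : N.+1%:R *: iter N dz F (m + 1) n =
    N.+1%:R *: iter N.+1 dz F m n + N.+1%:R *: iter N dz F m (n + 1) :> W.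
  by rewrite -scalerDr; congr (_ *: _); rewrite /= /dz subrK.
have hc : (- (n + 1))%:~R = (- n)%:~R - 1 :> K by rewrite opprD intrD.
rewrite hB hc -[N.+2]addn1 natrD scalerBr !scalerDl scaleN1r scale1r.
move: (iter N.+1 dz F m n) (_ *: iter N dz F m _) => x y.
by rewrite addrA [X in _ - X]addrC addrKA opprD opprK addrACA.
Qed.

(** Differentiating a field costs at most one more power of z - w. *)
Lemma vanish_dw N F :
  vanish N F -> vanish N.+1 (fun m n => (- n)%:~R *: F m (n - 1)).
Proof.
move=> hF m n; rewrite iter_dz_dw hF scaler0 addr0.
by rewrite (vanishW hF (leqnSn N)) scaler0.
Qed.

(** Links the iterates of [dz] to the binomial sum in the locality axiom; the induction is Pascal's
    rule. *)
Lemma iter_dzE N F m n :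
  iter N dz F m n = \sum_(j < N.+1) ((-1) ^+ j * 'C(N, j)%:R : K) *:
                       F (m + N%:Z - j%:Z) (n + j%:Z).
Proof.
elim: N m n => [|N IH] m n.
  by rewrite big_ord1 /= expr0 bin0 mulr1 scale1r; congr (F _ _); lia.
rewrite iterS /dz !IH [RHS]big_ord_recl [X in X - _]big_ord_recl /=.
rewrite !bin0 -addrA; congr (_ + _).
  by congr (_ *: F _ _); lia.
under [RHS]eq_bigr => j _ do rewrite binS natrD mulrDr scalerDl.
rewrite big_split [X in _ = X + _]big_ord_recr /= bin_small // mulr0 scale0r addr0.
rewrite -sumrN; congr (_ + _); apply: eq_bigr => j _; rewrite /bump leq0n add1n.
  by congr (_ *: F _ _); lia.
rewrite exprS mulN1r mulNr scaleNr; congr (- (_ *: F _ _)); lia.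
Qed.

End Locality.

(** * The commutator of Y(a,z) and Y(q n,w) applied to d in U, with coefficients [ucomm] *)

Definition ucomm (a : laurent) (q : {poly C}) (d : laurent) (m l : int) : {poly C} :=
  uact a m (nact q l d) - nact q l (lmul (hs a m) d).

Lemma ucommPa c a b q d m l :
  ucomm (c *: a + b) q d m l = c *: ucomm a q d m l + ucomm b q d m l.
Proof.
by rewrite /ucomm uactPl hsP lmulPl nactPr -!mul_polyC; ring.
Qed.

Lemma ucommPq a c p q d m l :
  ucomm a (c *: p + q) d m l = c *: ucomm a p d m l + ucomm a q d m l.
Proof. by rewrite /ucomm !nactPl uactPr -!mul_polyC; ring. Qed.

Lemma ucommX a q d m l :
  ucomm a ('X * q) d m l = (- l)%:~R *: ucomm a q d m (l - 1).
Proof. by rewrite /ucomm !nactX_E uactZr scalerBr. Qed.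

Lemma ucomm_vac q d m l : ucomm lone q d m l = 0.
Proof.
rewrite /ucomm uact1 hs1; case: (m == -1); first by rewrite lmul1l subrr.
by rewrite lmul0l nact0r subr0.
Qed.

Lemma nact1 l d : nact 1 l d = nbase l d.
Proof. by rewrite -polyC1 nactC scale1r. Qed.

(** In the first term t acts as z - d/dX, and d/dX on e^(wX) d(-w) is w. In the second, t a expands
    to (t+z) a(t+z), where the inner t becomes -w. Both give the factor z - w. *)
Lemma ucomm_t a d m l : ucomm (tmul a) 1 d m l = dz (ucomm a 1 d) m l.
Proof.
rewrite /dz /ucomm !nact1 uact_t -(deriv_nbase l d) uact_deriv.
by rewrite hs_t lmulDl -[X in nbase l (X + _)]scale1r nbaseP lmul_tl nbase_t scale1r; ring.
Qed.

Lemma iter_ucomm_t N a d m l :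
  ucomm (iter N tmul a) 1 d m l = iter N dz (ucomm a 1 d) m l.
Proof. by elim: N m l => // N IH m l; rewrite iterS ucomm_t /= /dz !IH. Qed.

(* Writing a = a_0 + t a', ucomm_t reduces the pair (m, l) for a to (m+1, l) and
   (m, l+1) for a'; both fields vanish once m or l is large. *)
Lemma ucomm_regular a d m l : vge 0 a -> ucomm a 1 d m l = 0.
Proof.
have [L hd] := vge_exists d.
(* The induction runs on a bound s for -m-L-l. At s = 0, m < 0 forces l >= -L, so each of the two
   terms vanishes whatever the sign of m. *)
have [s hs_le] : exists s : nat, - m - L - l <= s%:Z by exists (absz (- m - L - l)%R); lia.
elim: s a m l hs_le => [|s IH] a m l hml ha; last first.
  have [a' ha' ->] := laurent_split ha.
  by rewrite ucommPa ucomm_vac ucomm_t /dz !IH ?scaler0 ?subr0 ?addr0 //; lia.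
rewrite /ucomm; case: (boolP (0 <= m)) => hm.
  by rewrite uact_regular // hs_ge0 // lmul0l nact0r subr0.
have hl : - L <= l by lia.
have hL := vge_lmul (vge_hs m ha) hd; rewrite add0r in hL.
by rewrite !nact1 (nbase_eq0 hd) // (nbase_eq0 hL) // uact0r subr0.
Qed.

(** The exponent is uniform in d, as locality requires: a power of t making a regular serves for
    constant q, and each factor X adds one. *)
Lemma ucomm_vanish a q : exists N, forall d, vanish N (ucomm a q d).
Proof.
have [N0 hN0] := vge_regular a.
elim/poly_indX: q => [k|p q [N hN] [M hM]|p [N hN]].
- exists N0 => d m l.
  have h : ucomm a k%:P d =2 fun m l => k *: ucomm a 1 d m l + 0.
    move=> i j; have := ucommPq a k 1 0 d i j.
    rewrite addr0 -mul_polyC mulr1 => ->; congr (_ + _).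
    by rewrite /ucomm !nact0l uact0r subr0.
  rewrite (eq_iter_dz _ h) iter_dzP -iter_ucomm_t ucomm_regular // scaler0 add0r.
  exact: vanish0.
- exists (maxn N M) => d m l.
  have h : ucomm a (p + q) d =2 fun m l => 1 *: ucomm a p d m l + ucomm a q d m l.
    by move=> i j; rewrite -ucommPq scale1r.
  rewrite (eq_iter_dz _ h); apply: vanishP.
    by apply: vanishW (hN d) (leq_maxl _ _).
  by apply: vanishW (hM d) (leq_maxr _ _).
- exists N.+1 => d m l; rewrite (eq_iter_dz _ (ucommX a p d)).
  exact: (vanish_dw (hN d)).
Qed.

(** * The vertex algebra structure on the sum of U and N *)

Definition inN (p : {poly C}) : V := (0, p).

Lemma V_ext (u v : V) : u.1 = v.1 -> u.2 = v.2 -> u = v.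
Proof. by case: u v => [a p] [b q] /= -> ->. Qed.

Lemma V_split (u : V) : u = inU u.1 + inN u.2.
Proof. by apply: V_ext; rewrite /= ?addr0 ?add0r. Qed.

Lemma inNP c p q : inN (c *: p + q) = c *: inN p + inN q.
Proof. by apply: V_ext; rewrite //= scaler0 addr0. Qed.

Lemma inN_C c : inN c%:P = c *: ngen.
Proof. by apply: V_ext; rewrite /= ?scaler0 // -mul_polyC mulr1. Qed.

Lemma inN_X p : inN ('X * p) = Tv (inN p).
Proof.
by apply: V_ext => //=; apply: laurent_ext => k /=; rewrite mulr0.
Qed.

Lemma inN_D p q : inN (p + q) = inN p + inN q.
Proof. by rewrite -[p]scale1r inNP !scale1r. Qed.

Lemma inN_B p q : inN (p - q) = inN p - inN q.
Proof. by apply: V_ext; rewrite //= subr0. Qed.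

Lemma inN_Z c p : inN (c *: p) = c *: inN p.
Proof. by apply: V_ext; rewrite //= scaler0. Qed.

Lemma iter_dz_inN N (F : int -> int -> {poly C}) m n :
  iter N dz (fun m n => inN (F m n)) m n = inN (iter N dz F m n).
Proof.
elim: N m n => //= N IH m n; rewrite /dz !IH.
by apply: V_ext; rewrite //= subr0.
Qed.

(** No term pairs [u.2] with [v.2]: products of two elements of N are zero. *)
Definition Yop (n : int) (u v : V) : V :=
  (lmul (hs u.1 n) v.1, uact u.1 n v.2 + nact u.2 n v.1).

(** Fields of elements of U commute on U and on N, and products within N vanish, so only the two
    mixed commutators remain. *)
Lemma Yop_comm m n (u v c : V) :
  Yop m u (Yop n v c) - Yop n v (Yop m u c) =
  inN (ucomm u.1 v.2 c.1 m n - ucomm v.1 u.2 c.1 n m).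
Proof.
apply: V_ext; rewrite /=; first by rewrite lmul_leftC subrr.
by rewrite !uactDr uact_comm /ucomm; ring.
Qed.

Lemma Yop_vertex_algebra : vertex_algebra vac Tv Yop.
Proof.
split.
  move=> c u v; apply: V_ext => /=; first exact: lderivP.
  by rewrite mulrDr scalerAr.
split.
- split=> n c u v w; apply: V_ext => /=.
  + by rewrite hsP lmulPl.
  + by rewrite uactPl nactPl scalerDr addrACA.
  + by rewrite lmulPr.
  + by rewrite uactPr nactPr scalerDr addrACA.
- move=> u v; have [M hM] := uact_lbound u.1 v.2.
  have [L hL] := nact_lbound u.2 v.1.
  exists (Num.max 0 (Num.max M L)) => n hn; apply: V_ext => /=.
    by rewrite hs_ge0 ?lmul0l //; lia.
  by rewrite hM ?hL ?addr0 //; lia.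
- split=> [n u|u|n u|].
  + apply: V_ext; rewrite /= ?nact0l ?addr0 ?uact1 ?hs1; case: (n == -1) => //=.
      exact: lmul1l.
    exact: lmul0l.
  + by apply: V_ext; rewrite /Yop /vac /inU ?hsN1 ?lmul1r //= nactN1_vac uact0r add0r.
  + by apply: V_ext; rewrite /= ?lmul0l // uact0r nact_vac_ge0 ?addr0.
  + by apply: V_ext; rewrite /= ?lderiv1 ?mulr0.
- move=> n u v; apply: V_ext => /=.
    rewrite lderivM lderiv_hs addrK lmulZl mulrNz; apply: laurent_ext => k /=; ring.
  have := nact_transl n u.2 v.1; rewrite mulrNz scalerDr => <-.
  by rewrite mulrDr uactX_E -!mul_polyC; ring.
- move=> u v; have [N hN] := ucomm_vanish u.1 v.2; have [M hM] := ucomm_vanish v.1 u.2.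
  (* The second mixed commutator has its variables exchanged, which changes (z-w)^M only by a
     sign. *)
  exists (maxn N M) => m n c.
  rewrite -(iter_dzE _ (fun m n => Yop m u (Yop n v c) - Yop n v (Yop m u c))).
  rewrite (eq_iter_dz _ (fun m n => Yop_comm m n u v c)) iter_dz_inN.
  have h : (fun m n => ucomm u.1 v.2 c.1 m n - ucomm v.1 u.2 c.1 n m) =2
     (fun m n => (-1) *: ucomm v.1 u.2 c.1 n m + ucomm u.1 v.2 c.1 m n).
    by move=> i j; rewrite scaleN1r addrC.
  rewrite (eq_iter_dz _ h) vanishP //.
    by apply: vanish_swap; apply: vanishW (hM c.1) (leq_maxr _ _).
  by apply: vanishW (hN c.1) (leq_maxl _ _).
Qed.

Lemma Yop_prescribed : prescribed Yop.
Proof.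
split=> [a b k|a b k|n|a n].
- have -> : - k%:Z - 1 = Negz k by lia.
  by apply: V_ext; rewrite /= ?lmulZl // uact0r nact0l addr0.
- by apply: V_ext; rewrite /= ?lmul0l // uact0r nact0l addr0.
- by apply: V_ext; rewrite /= ?lmul0r // uact0l nact0r addr0.
- apply: V_ext; rewrite /= ?lmul0r ?scaler0 //.
  by rewrite nact0l addr0 -polyC1 uactC mul1r -mul_polyC mulr1.
Qed.

(** Vanishing for m >= 0 means that F has no negative powers of z. Setting z = 0 in (z-w)^N F = 0
    leaves (-w)^N times the constant term in z, which is therefore zero. *)
Lemma vanish_edge (K : fieldType) (W : lmodType K) N (F : int -> int -> W) :
    vanish N F -> (forall m n, 0 <= m -> F m n = 0) -> forall n, F (-1) n = 0.
Proof.
move=> hF F0 n.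
have it0 i m k : 0 <= m -> iter i dz F m k = 0.
  elim: i m k => [|i IH] m k hm; first exact: F0.
  by rewrite /= /dz !IH ?subr0 //; lia.
have it1 i k : iter i dz F (-1) k = (-1) ^+ i *: F (-1) (k + i%:Z).
  elim: i k => [|i IH] k; first by rewrite /= expr0 scale1r addr0.
  rewrite /= /dz it0 // IH sub0r exprS mulN1r scaleNr.
  by congr (- (_ *: F _ _)); lia.
have := hF (-1) (n - N%:Z); rewrite it1 subrK => /eqP.
by rewrite scaler_eq0 signr_eq0 => /eqP.
Qed.

(** * Uniqueness of the structure *)

Section Uniqueness.
Context (Y : int -> V -> V -> V).
Context (Yva : vertex_algebra vac Tv Y) (Ypr : prescribed Y).

Let YPl n c u v w : Y n (c *: u + v) w = c *: Y n u w + Y n v w.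
Proof. by case: Yva => _ [[h _] _ _ _ _]. Qed.

Let YPr n c u v w : Y n w (c *: u + v) = c *: Y n w u + Y n w v.
Proof. by case: Yva => _ [[_ h] _ _ _ _]. Qed.

Let Y0r n w : Y n w 0 = 0.
Proof. by have := YPr n (-1) 0 0 w; rewrite scaler0 addr0 scaleN1r addNr. Qed.

Let YDl n u v w : Y n (u + v) w = Y n u w + Y n v w.
Proof. by rewrite -[u]scale1r YPl !scale1r. Qed.

Let YDr n u v w : Y n w (u + v) = Y n w u + Y n w v.
Proof. by rewrite -[u]scale1r YPr !scale1r. Qed.

Let YZr n c u w : Y n w (c *: u) = c *: Y n w u.
Proof. by rewrite -[c *: u]addr0 YPr Y0r addr0. Qed.

Let Yvac_ge0 n u : 0 <= n -> Y n u vac = 0.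
Proof. by case: n => // n _; case: Yva => _ [_ _ [_ _ h _] _ _]. Qed.

Let YN1_vac u : Y (-1) u vac = u.
Proof. by case: Yva => _ [_ _ [_ h _ _] _ _]. Qed.

Let Y_T n u v : Y n u (Tv v) = Tv (Y n u v) + n%:~R *: Y (n - 1) u v.
Proof.
case: Yva => _ [_ _ _ h _]; have := h n u v; rewrite scaleNr => /eqP.
by rewrite subr_eq => /eqP ->; rewrite addrAC addNr add0r.
Qed.

Let Ylocal u v : exists N, forall c,
  vanish N (fun m n => Y m u (Y n v c) - Y n v (Y m u c)).
Proof.
case: Yva => _ [_ _ _ _ h]; have [N hN] := h u v.
by exists N => c m n; rewrite iter_dzE.
Qed.

Let Y_UU n a b : Y n (inU a) (inU b) = inU (lmul (hs a n) b).
Proof.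
case: Ypr => h1 h2 _ _; case: n => q; first by rewrite h2 /= lmul0l.
have e : Negz q = - q%:Z - 1 by lia.
by rewrite {1}e h1 /= lmulZl.
Qed.

Let Y_UN n a p : Y n (inU a) (inN p) = inN (uact a n p).
Proof.
case: Ypr => _ _ _ h4.
elim/poly_indX: p n => [c|p q IHp IHq|p IH] n.
- by rewrite inN_C YZr h4 uactC inN_C scalerA.
- by rewrite uactDr !inN_D YDr IHp IHq.
- by rewrite inN_X Y_T !IH uactX_E inN_D inN_X inN_Z.
Qed.

(** As T kills the vacuum, translation covariance determines each coefficient of Y(u,z) vac from the
    preceding one, up to a nonzero integer factor. *)
Let Y_N_vac n p : Y n (inN p) vac = inN (nact p n lone).
Proof.
case: n => q; first by rewrite Yvac_ge0 // nact_vac_ge0.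
elim: q => [|q IH]; first by rewrite YN1_vac nactN1_vac.
have hT : Tv vac = 0 by case: Yva => _ [_ _ [_ _ _ h] _ _].
have h1 := Y_T (Negz q) (inN p) vac.
have h2 := nact_transl (Negz q) p lone.
rewrite lderiv1 nact0r subr0 in h2.
have e : Negz q - 1 = Negz q.+1 by lia.
move: h1; rewrite hT Y0r IH -inN_X h2 e inN_Z mulrNz scaleNr => /esym/eqP.
rewrite addrC subr_eq0 => /eqP.
by apply: scalerI; rewrite NegzE mulrNz oppr_eq0 natC_neq0.
Qed.

Let Y_NU n p a : Y n (inN p) (inU a) = inN (nact p n a).
Proof.
have [N hN] := Ylocal (inU a) (inN p); have [M hM] := ucomm_vanish a p.
(* Since hs a m = a_(m) vac, F is the discrepancy on Y(a,z) vac. The two candidates agree on the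
   vacuum, so F is a difference of two local commutators; the mode m = -1 recovers a itself. *)
pose F (m l : int) := Y l (inN p) (inU (hs a m)) - inN (nact p l (hs a m)).
have FE : F =2 fun m l => (-1) *: (Y m (inU a) (Y l (inN p) vac) - Y l (inN p) (Y m (inU a) vac))
                          + inN (ucomm a p lone m l).
  move=> m l; rewrite Y_N_vac Y_UN /vac Y_UU lmul1r /ucomm lmul1r scaleN1r opprB.
  by rewrite inN_B addrA subrK.
have F0 m l : 0 <= m -> F m l = 0.
  by move=> hm; rewrite /F hs_ge0 // nact0r Y0r subrr.
have Fv : vanish (maxn N M) F.
  move=> m l; rewrite (eq_iter_dz _ FE); apply: vanishP.
    by apply: vanishW (hN vac) (leq_maxl _ _).
  move=> i j; rewrite iter_dz_inN (vanishW (hM lone) (leq_maxr _ _)) //.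
have := vanish_edge Fv F0 n; rewrite /F hsN1 => /eqP.
by rewrite subr_eq0 => /eqP.
Qed.

Let Y_N_of_ngen u : (forall n, Y n u ngen = 0) -> forall n p, Y n u (inN p) = 0.
Proof.
move=> h n p; elim/poly_indX: p n => [c|p q IHp IHq|p IH] n.
- by rewrite inN_C YZr h scaler0.
- by rewrite inN_D YDr IHp IHq addr0.
- rewrite inN_X Y_T !IH scaler0 addr0.
  by apply: V_ext; rewrite /= ?mulr0 //; apply: laurent_ext => k /=; rewrite mulr0.
Qed.

Let Y_NN n p q : Y n (inN p) (inN q) = 0.
Proof.
apply: (Y_N_of_ngen _) => {}n {q}.
have [N hN] := Ylocal (inN p) ngen.
(* Y(n,z) kills n, hence all of N. *)
have ng0 := Y_N_of_ngen (let: And4 _ _ h _ := Ypr in h).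
(* The swap puts the variable of Y(n,z) first: its mode -1 turns the vacuum into n, while the other
   order of the product is zero by [ng0]. *)
have hv := vanish_swap (hN vac).
have := vanish_edge hv _ n; rewrite YN1_vac Y_N_vac ng0 subr0; apply.
by move=> m l hm; rewrite Yvac_ge0 // Y0r Y_N_vac ng0 subr0.
Qed.

Lemma Yop_unique : Y = Yop.
Proof.
apply: funext => n; apply: funext => u; apply: funext => v.
rewrite [u in LHS]V_split [v in LHS]V_split YDl !YDr Y_UU Y_UN Y_NU Y_NN addr0.
by apply: V_ext; rewrite /= ?addr0 ?add0r.
Qed.

End Uniqueness.

(** * The central series *)

Lemma TsubmoduleN : Tsubmodule Tv (fun v : V => v.1 = 0).
Proof.
split=> //= [u v -> ->|c u ->|u ->]; rewrite ?addr0 ?scaler0 //.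
by apply: laurent_ext => k /=; rewrite mulr0.
Qed.

(** The expansion of a(t+z) has no negative powers of z, so the products with j >= 0 have no
    component in U. *)
Lemma central_series_subN k v : central_series Tv Yop k.+1 v -> v.1 = 0.
Proof.
move=> h; apply: (h (fun v : V => v.1 = 0)) => [|_ [a [b [j [_ ->]]]]].
  exact: TsubmoduleN.
by rewrite /= lmul0l.
Qed.

Lemma N_sub_central_series k p : central_series Tv Yop k (inN p).
Proof.
elim: k p => // k IH p S [S0 SD SZ ST] hS.
(* The witness is a = t^(-1): its product a_(0) n is n, so n survives in every term of the
   series. *)
have hP : exists m : int, forall j, j < m -> (if j == -1 then 1 else 0 : C) = 0.
  by exists (-1) => j hj; rewrite ifF //; lia.
have Sn : S ngen.
  apply: hS; exists (inU (Laurent hP)), ngen, 0%N; split; first exact: IH.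
  apply: V_ext; rewrite /= ?lmul0r // nact0l addr0 -polyC1 uactC /=.
  by rewrite mul1r.
elim/poly_indX: p => [c|p q hp hq|p hp].
- by rewrite inN_C; apply: SZ.
- by rewrite inN_D; apply: SD.
- by rewrite inN_X; apply: ST.
Qed.

Theorem theorem5p5 :
  exists Y : int -> V -> V -> V,
    [/\ vertex_algebra vac Tv Y /\ prescribed Y,
        (forall Y' : int -> V -> V -> V,
           vertex_algebra vac Tv Y' /\ prescribed Y' -> Y' = Y) &
        (exists k0 : nat, forall k : nat, (k0 <= k)%N ->
           forall v : V, central_series Tv Y k v <-> v.1 = 0)].
Proof.
exists Yop; split.
- exact: conj Yop_vertex_algebra Yop_prescribed.
- by move=> Y' [hva hpr]; apply: Yop_unique.
(* The series already equals N at its first step. *)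
- exists 1%N => -[//|k] _ v; split; first exact: central_series_subN.
  move=> v0; have -> : v = inN v.2 by exact: V_ext.
  exact: N_sub_central_series.
Qed.
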